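(* Let $C\subset\mathbb{R}^2$ be a fixed compact convex set with nonempty interior, and for each $n\ge 1$ let $\xi_n$ be a set of $n$ independent random points chosen uniformly from $C$. For each $n$ let $\mathcal{G}_n$ be the family of squares of side length $1/\sqrt n$ defined by a (deterministic) square grid with mesh $1/\sqrt n$ on the plane. Let $P$ be a fixed order type. Then, as $n\to\infty$, $$\mathbb{P}\bigl(\xi_n\cap Q\ \text{is of type}\ P\ \text{for some square}\ Q\in\mathcal{G}_n\bigr)\ \longrightarrow\ 1.$$
   Context: A finite set in $\mathbb{R}^2$ is in general position if no three of its points are collinear. Two finite sets $A,B\subset\mathbb{R}^2$ are of the same type if both are in general position and there is a one-to-one correspondence $a_i\leftrightarrow b_i$ ($i=1,\dots,k$) between $A=\{a_1,\dots,a_k\}$ and $B=\{b_1,\dots,b_k\}$ such that the orientations of the triangles $(a_h,a_i,a_j)$ and $(b_h,b_i,b_j)$ are the same for all $1\le h<i<j\le k$. Being of the same type is an equivalence relation (on finite planar sets in general position), and its equivalence classes are called order types. A finite set is of type $P$ if it belongs to the equivalence class $P$. The points of $\xi_n$ are independent and each uniformly distributed in $C$ (normalized Lebesgue measure). *)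

(* Defs.v *)
From HB Require Import structures.
From mathcomp Require Import all_boot all_order all_algebra.
From mathcomp Require Import all_classical all_reals all_analysis.
Import Order.TTheory GRing.Theory Num.Theory numFieldNormedType.Exports.

Set Implicit Arguments.
Unset Strict Implicit.
Unset Printing Implicit Defensive.

Local Open Scope classical_set_scope.
Local Open Scope ring_scope.

Definition collinear (R : realType) (p q r : R * R) : Prop :=
  exists a b c : R, (a, b) <> (0, 0) /\
    forall x : R * R, [\/ x = p, x = q | x = r] -> a * x.1 + b * x.2 = c.

Definition general_position (R : realType) (A : set (R * R)) : Prop :=
  forall p q r : R * R, A p -> A q -> A r ->
    p <> q -> q <> r -> p <> r -> ~ collinear p q r.

(* 1 if the triangle (p, q, r) is positively (counterclockwise) oriented, -1 if
   it is negatively oriented, 0 if it is degenerate *)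
Definition orientation (R : realType) (p q r : R * R) : R :=
  Num.sg ((q.1 - p.1) * (r.2 - p.2) - (q.2 - p.2) * (r.1 - p.1)).

(* The correspondence a_i <-> b_i is carried by repetition-free enumerations
   of A and B by the same 'I_k; k <= 2 imposes no orientation condition. *)
Definition same_type (R : realType) (A B : set (R * R)) : Prop :=
  [/\ finite_set A, finite_set B, general_position A, general_position B &
    exists k (a b : 'I_k -> R * R),
      [/\ injective a, injective b, range a = A, range b = B &
        forall h i j : 'I_k, (h < i)%N -> (i < j)%N ->
          orientation (a h) (a i) (a j) = orientation (b h) (b i) (b j)]].

(* Order types are the equivalence classes of same_type on the finite sets in
   general position; "A is of type P" is the membership P A. *)
Definition order_type (R : realType) (P : set (set (R * R))) : Prop :=
  exists A : set (R * R),
    [/\ finite_set A, general_position A & P = [set B | same_type A B]].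

(* R * R as a measurable type (product of the Borel sigma-algebras), with the
   instance that carries lebesgue_measure *)
Notation borel_plane R := (measurableTypeR R * measurableTypeR R)%type.

Definition area (R : realType) : set (borel_plane R) -> \bar R :=
  product_measure1 (@lebesgue_measure R) (@lebesgue_measure R).

Definition uniform_on (R : realType) (C : set (R * R))
    (d : measure_display) (T : measurableType d) (Pr : probability T R)
    (X : {RV Pr >-> borel_plane R}) : Prop :=
  forall B : set (borel_plane R), measurable B ->
    distribution Pr X B = (area (B `&` C) / area C)%E.

(* Mutual independence: the product rule over every subfamily. *)
Definition independent_RVs (R : realType) (d d' : measure_display)
    (T : measurableType d) (T' : measurableType d') (Pr : probability T R)
    (I : finType) (X : I -> {RV Pr >-> T'}) : Prop :=
  forall (J : {set I}) (B : I -> set T'), (forall i, measurable (B i)) ->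
    Pr (\bigcap_(i in [set` J]) (X i @^-1` B i)) =
    (\prod_(i in J) Pr (X i @^-1` B i))%E.

(* The closed cell of index (i, j) of the square grid of mesh h with origin o
   and axes directed by the unit vector u and by u rotated by a right angle:
   s and t are the coordinates of x in that orthonormal frame. *)
Definition grid_square (R : realType) (h : R) (o u : R * R) (i j : int) :
    set (R * R) :=
  [set x | let s := (x.1 - o.1) * u.1 + (x.2 - o.2) * u.2 in
           let t := (x.2 - o.2) * u.1 - (x.1 - o.1) * u.2 in
           i%:~R * h <= s <= (i + 1)%:~R * h /\
           j%:~R * h <= t <= (j + 1)%:~R * h].

Definition square_grid (R : realType) (h : R) (G : set (set (R * R))) : Prop :=
  exists o u : R * R, u.1 ^+ 2 + u.2 ^+ 2 = 1 /\
    G = [set Q | exists i j : int, Q = grid_square h o u i j].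

(* Main.v *)
Require Import Defs.
From HB Require Import structures.
From mathcomp Require Import all_boot all_order all_algebra.
From mathcomp Require Import all_classical all_reals all_analysis.
From mathcomp Require Import measurable_realfun zify ring lra.
Import Order.TTheory GRing.Theory Num.Theory numFieldNormedType.Exports.

Local Open Scope classical_set_scope.
Local Open Scope ring_scope.

Set Implicit Arguments.
Unset Strict Implicit.
Unset Printing Implicit Defensive.

(** The proof is a second moment argument on a bounded number of squares.

    Fix representatives a_1, ..., a_k of the order type P.  Since all the
    triples of the a_i have a nonzero orientation, the type survives a small
    perturbation of every a_i ([type_stable]).  Copy this configuration, scaled
    down, into a grid square Q: around each copy there is a small box, of area
    proportional to 1/n, such that any choice of one point in every box is of
    type P ([square_grid_patterns]).  The boxes are axis-parallel even when the
    grid is rotated, so that their area is immediate; the area of Q itself is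
    only needed up to a constant factor, and Q lies in an axis-parallel box of
    area 4/n.

    Let M be fixed.  For n large, M pairwise disjoint grid squares Q_1, ...,
    Q_M fit inside a ball contained in C.  For an injection f of the k indices
    of the pattern into the n indices of the sample, say that f hits Q_m when
    the sample point f(i) falls in the i-th box of Q_m for every i and no other
    sample point falls in Q_m; then the points in Q_m are of type P
    ([hit_same_type]).  The expected number c of hits (m, f) is at least
    M kappa, where kappa > 0 does not depend on n or M ([prob_hit_ge],
    [occupancy_ge]).  Two distinct hits of the same square are incompatible
    ([hit_disjoint]), and hits of two distinct squares are nearly
    independent: the probability of both is at most (1 - p)^(-2k) times the
    product, where p = O(1/n) bounds the probability of one square
    ([prob_hitI_le]).  The second moment inequality bounds the probability that
    there is no hit by 1/c + (1 - p)^(-2k) - 1 ([prob_no_hit]).  Letting n, and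
    then M, tend to infinity gives the theorem.

    The event has to be measurable for its probability to be meaningful: it is
    a countable union, over the squares and the enumerations of the points,
    of finite conjunctions of conditions on signs of polynomials
    ([measurable_same_type]). *)

(** * The second moment method *)

Lemma ge0_sum_indic (R : realType) (d : measure_display) (T : measurableType d)
    (Pr : probability T R) (K : finType) (a : K -> R) (S : K -> set T) :
  (forall k, measurable (S k)) ->
  (forall w, 0 <= \sum_k a k * \1_(S k) w) ->
  0 <= \sum_k a k * fine (Pr (S k)).
Proof.
move=> mS ge0.
have int k : Pr.-integrable setT (fun w => (a k)%:E * (\1_(S k) w)%:E)%E.
  by apply: integrableZl => //; exact: integrable_indic.
have -> : \sum_k a k * fine (Pr (S k)) = \int[Pr]_w (\sum_k a k * \1_(S k) w).
  rewrite /Rintegral.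
  under eq_integral => w _ do rewrite -sumEFin.
  rewrite integral_sum//= -EFin_sum_fine => [/=|k _]; last by apply: integrable_fin_num (int k).
  apply: eq_bigr => k _.
  under eq_integral do rewrite EFinM.
  rewrite integralZl//; last exact: integrable_indic.
  by rewrite integral_indic// setIT fineM// fin_num_measure.
by apply: Rintegral_ge0.
Qed.

(** With N the number of the events A_i that occur and c its expectation, the
    square (N - c)^2 is nonnegative and equals c^2 when N = 0; take expectations.
    Dividing by c^2 gives P(N = 0) <= Var N / c^2. *)
Lemma second_moment (R : realType) (d : measure_display) (T : measurableType d)
    (Pr : probability T R) (I : finType) (A : I -> set T) :
  (forall i, measurable (A i)) ->
  fine (Pr (~` \bigcup_i A i)) * (\sum_i fine (Pr (A i))) ^+ 2 <=
  (\sum_i \sum_j fine (Pr (A i `&` A j))) - (\sum_i fine (Pr (A i))) ^+ 2.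
Proof.
move=> mA; set c := \sum_i fine (Pr (A i)).
have mU : measurable (\bigcup_i A i).
  by apply: fin_bigcup_measurable => //; exact: finite_finset.
(* (N - c)^2 - c^2 1_(N = 0), expanded as one combination of indicators of
   setT, the event N = 0, the A_i and the intersections of two of them *)
pose a (k : bool + (I + I * I)) : R := match k with
  | inl b => if b then c ^+ 2 else - c ^+ 2
  | inr (inl _) => - 2 * c
  | inr (inr _) => 1 end.
pose S (k : bool + (I + I * I)) : set T := match k with
  | inl b => if b then setT else ~` \bigcup_i A i
  | inr (inl i) => A i
  | inr (inr p) => A p.1 `&` A p.2 end.
have mS k : measurable (S k).
  by case: k => [[]|[i|[i j]]] //=; [exact: measurableC|exact: measurableI].
have split (F : (bool + (I + I * I))%type -> R) : \sum_k F k =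
    F (inl true) + F (inl false) +
    (\sum_i F (inr (inl i)) + \sum_i \sum_j F (inr (inr (i, j)))).
  rewrite big_sumType/= big_bool; congr (_ + _).
  by rewrite big_sumType/= pair_big; congr (_ + _); apply: eq_bigr => -[].
have := @ge0_sum_indic R d T Pr _ a S mS.
rewrite split /= probability_setT /=.
under [in X in _ <= _ + (_ + X)]eq_bigr do under eq_bigr do rewrite mul1r.
rewrite -mulr_sumr -/c => H.
suff : 0 <= c ^+ 2 * 1 + - c ^+ 2 * fine (Pr (~` \bigcup_i A i)) +
  (- 2 * c * c + \sum_i \sum_j fine (Pr (A i `&` A j))) by lra.
apply: H => w; rewrite split /=.
under [X in _ <= _ + (_ + X)]eq_bigr do under eq_bigr do
  rewrite mul1r indicI /=.
under [X in _ <= _ + (_ + X)]eq_bigr do rewrite -mulr_sumr.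
rewrite -mulr_suml -mulr_sumr indicT /=.
set N := \sum_i \1_(A i) w.
have [[i _ Aiw]|nA] := pselect ((\bigcup_i A i) w).
  rewrite [\1_(~` _) _]indicE memNset ?mulr0; last by move=> /=; apply; exists i.
  by have := sqr_ge0 (c - N); rewrite /=; lra.
have -> : N = 0.
  apply: big1 => i _; rewrite indicE memNset// => Aiw; apply: nA; by exists i.
rewrite indicE mem_set//=; lra.
Qed.

(** * Sample points hitting a pattern *)

(** The constraint that a hit along f puts on the sample point j.  The encoding
    is meant for injective f, where at most one index i can be picked. *)
Definition slot (U : Type) (k n : nat) (Q : set U) (B : 'I_k -> set U)
    (f : 'I_k -> 'I_n) (j : 'I_n) : set U :=
  if [pick i | f i == j] is Some i then B i else ~` Q.

Definition hit (U V : Type) (k n : nat) (X : 'I_n -> V -> U) (Q : set U)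
    (B : 'I_k -> set U) (f : 'I_k -> 'I_n) : set V :=
  \bigcap_j (X j @^-1` slot Q B f j).

Lemma slot_in (U : Type) (k n : nat) (Q : set U) (B : 'I_k -> set U)
    (f : 'I_k -> 'I_n) (i : 'I_k) : injective f -> slot Q B f (f i) = B i.
Proof.
move=> f_inj; rewrite /slot; case: pickP => [i' /eqP/f_inj ->//|/(_ i)].
by rewrite eqxx.
Qed.

Lemma slot_out (U : Type) (k n : nat) (Q : set U) (B : 'I_k -> set U)
    (f : 'I_k -> 'I_n) (j : 'I_n) : j \notin codom f -> slot Q B f j = ~` Q.
Proof.
move=> jf; rewrite /slot; case: pickP => // i /eqP fi.
by move: jf; rewrite -fi codom_f.
Qed.

(** A point used by f and not by g would have to be both inside and outside Q,
    and a point used by both at different places would be in two disjoint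
    boxes. *)
Lemma hit_disjoint (U V : Type) (k n : nat) (X : 'I_n -> V -> U) (Q : set U)
    (B : 'I_k -> set U) (f g : {ffun 'I_k -> 'I_n}) :
  (forall i, B i `<=` Q) ->
  (forall i i', i != i' -> B i `&` B i' = set0) ->
  injective f -> injective g -> f != g ->
  hit X Q B f `&` hit X Q B g = set0.
Proof.
move=> BQ Bdisj f_inj g_inj fg.
have [i fgi] : exists i, f i != g i.
  apply/existsP; apply: contra_neqT fg => /existsPn fg; apply/ffunP => i.
  by apply/eqP; move: (fg i); rewrite negbK.
rewrite -subset0 => w [/= Hf Hg].
have := Hf (f i) I; rewrite /= slot_in// => Bi.
have := Hg (f i) I; rewrite /=.
have [/codomP[i' fi]|fig] := boolP (f i \in codom g); last first.
  by rewrite slot_out// => nQ; apply: nQ; exact: BQ Bi.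
rewrite {1}fi slot_in// => Bi'.
have ii' : i != i' by apply: contra_neq fgi => e; rewrite fi -e.
suff : set0 (X (f i) w) by [].
by rewrite -(Bdisj _ _ ii').
Qed.

Lemma prod_codom (R : comPzSemiRingType) (k n : nat) (x : R) (f : 'I_k -> 'I_n) :
  injective f -> \prod_(j < n) x ^+ (j \in codom f) = x ^+ k.
Proof.
move=> f_inj; rewrite -[RHS]expr1 -[in RHS](card_ord k) -(card_codom f_inj).
rewrite prodrXr expr1; congr (_ ^+ _).
by rewrite -sum1_card [RHS]big_mkcond; apply: eq_bigr => j _; case: (_ \in _).
Qed.

Section Patterns.
Context (R : realType) (d d' : measure_display) (T : measurableType d)
  (U : measurableType d') (Pr : probability T R) (nu : probability U R)
  (n k : nat) (X : 'I_n -> {RV Pr >-> U}).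
Hypothesis X_indep : independent_RVs X.
Hypothesis X_law : forall j S, measurable S -> Pr (X j @^-1` S) = nu S.

(** A hit constrains every sample point, so that independence is used over the
    whole sample. *)
Lemma prob_bigcap (S : 'I_n -> set U) : (forall j, measurable (S j)) ->
  fine (Pr (\bigcap_j (X j @^-1` S j))) = \prod_j fine (nu (S j)).
Proof.
move=> mS; have := X_indep [set: 'I_n]%SET mS.
have -> : [set` [set: 'I_n]%SET] = setT by apply/seteqP; split => // j _ /=; rewrite inE.
move=> ->; apply: EFin_inj; rewrite -prodEFin fineK; last first.
  by apply: prode_fin_num => j _; rewrite X_law// fin_num_measure.
rewrite big_mkcond; apply: eq_bigr => j _.
by rewrite inE X_law// fineK// fin_num_measure.
Qed.

Lemma measurable_hit (Q : set U) (B : 'I_k -> set U) (f : 'I_k -> 'I_n) :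
  measurable Q -> (forall i, measurable (B i)) -> measurable (hit X Q B f).
Proof.
move=> mQ mB; apply: fin_bigcap_measurable => [|j _]; first exact: finite_finset.
rewrite -[X in measurable X]setTI; apply: measurable_funP => //.
by rewrite /slot; case: pickP => [i _|_] //; exact: measurableC.
Qed.

(** Each of the k points in the boxes contributes at least b >= b (1 - p), and
    each of the others at least 1 - p. *)
Lemma prob_hit_ge (Q : set U) (B : 'I_k -> set U) (f : 'I_k -> 'I_n) (p b : R) :
  measurable Q -> (forall i, measurable (B i)) -> injective f ->
  0 <= p <= 1 -> 0 <= b ->
  fine (nu Q) <= p -> (forall i, b <= fine (nu (B i))) ->
  b ^+ k * (1 - p) ^+ n <= fine (Pr (hit X Q B f)).
Proof.
move=> mQ mB f_inj /andP[p0 p1] b0 Qp bB.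
rewrite prob_bigcap => [|j]; last first.
  by rewrite /slot; case: pickP => [i _|_] //; exact: measurableC.
rewrite -(prod_codom b f_inj) -[X in _ ^+ X]card_ord -prodr_const -big_split/=.
apply: ler_prod => j _; apply/andP; split.
  by rewrite mulr_ge0 ?exprn_ge0// subr_ge0.
have [/codomP[i ->]|jf] := boolP (j \in codom f).
  rewrite slot_in// expr1; apply: le_trans (bB i).
  by rewrite ler_piMr// gerBl.
rewrite slot_out// expr0 mul1r probability_setC// fineB ?fin_num_measure//=.
by rewrite lerB.
Qed.

(** By independence both sides are products over the sample points, and they
    are compared factor by factor.  A point in no box contributes
    1 - q - q' <= (1 - q) (1 - q'), where q and q' are the probabilities of Q
    and Q'.  A point in a box of Q contributes the probability of this box on
    the left, but also the factor 1 - q' >= 1 - p on the right: one power of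
    (1 - p)^(-1) pays for it, and there are at most 2k such points.  A point
    in boxes of both squares makes the left-hand side vanish. *)
Lemma prob_hitI_le (Q Q' : set U) (B B' : 'I_k -> set U) (f f' : 'I_k -> 'I_n)
    (p : R) :
  measurable Q -> measurable Q' -> (forall i, measurable (B i)) ->
  (forall i, measurable (B' i)) ->
  (forall i, B i `<=` Q) -> (forall i, B' i `<=` Q') -> Q `&` Q' = set0 ->
  injective f -> injective f' ->
  p < 1 -> fine (nu Q) <= p -> fine (nu Q') <= p ->
  fine (Pr (hit X Q B f `&` hit X Q' B' f')) <=
  fine (Pr (hit X Q B f)) * fine (Pr (hit X Q' B' f')) *
  (1 - p)^-1 ^+ (2 * k).
Proof.
move=> mQ mQ' mB mB' BQ BQ' QQ' f_inj f'_inj p1 Qp Q'p.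
have mS j : measurable (slot Q B f j).
  by rewrite /slot; case: pickP => [i _|_] //; exact: measurableC.
have mS' j : measurable (slot Q' B' f' j).
  by rewrite /slot; case: pickP => [i _|_] //; exact: measurableC.
rewrite -bigcapI -[X in Pr X]/(\bigcap_j (X j @^-1` (slot Q B f j `&` slot Q' B' f' j))).
rewrite !prob_bigcap// => [|j]; last exact: measurableI.
rewrite mul2n -addnn exprD -{1}(prod_codom _ f_inj) -(prod_codom _ f'_inj).
rewrite -!big_split/=; apply: ler_prod => j _.
rewrite fine_ge0//=.
set w := (1 - p)^-1.
have w1 : 1 <= w by rewrite invf_ge1 ?subr_gt0// gerBl (le_trans _ Qp) ?fine_ge0.
have nuC S : measurable S -> fine (nu (~` S)) = 1 - fine (nu S).
  by move=> mS0; rewrite probability_setC// fineB ?fin_num_measure.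
have disj_le (S S' : set U) x : measurable S -> S' `<=` x -> measurable x ->
   fine (nu x) <= p -> fine (nu S) <= fine (nu S) * fine (nu (~` x)) * w.
  move=> mS0 _ mx xp; rewrite -mulrA ler_peMr ?fine_ge0// nuC//.
  by rewrite -ler_pdivrMr ?invr_gt0 ?subr_gt0// invrK mul1r lerB.
have le_nu S S' : measurable S -> measurable S' -> S `<=` S' -> fine (nu S) <= fine (nu S').
  by move=> mS0 mS0' SS'; rewrite fine_le ?fin_num_measure// le_measure ?inE.
have [/codomP[i ji]|jf] := boolP (j \in codom f).
  rewrite expr1 (_ : slot Q B f j = B i); last by rewrite ji slot_in.
  have [/codomP[i' ji']|jf'] := boolP (j \in codom f').
    rewrite expr1 (_ : slot Q' B' f' j = B' i'); last by rewrite ji' slot_in.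
    rewrite (_ : B i `&` B' i' = set0) ?measure0/=.
      by rewrite !mulr_ge0// ?fine_ge0// (le_trans _ w1).
    by rewrite -subset0 -QQ' => x [/BQ ? /BQ' ?].
  rewrite expr0 mulr1 slot_out//.
  apply: le_trans (_ : fine (nu (B i)) <= _).
    by apply: le_nu => //; apply: measurableI => //; exact: measurableC.
  exact: (disj_le _ (B' i)).
rewrite expr0 mul1r slot_out//.
have [/codomP[i' ji']|jf'] := boolP (j \in codom f').
  rewrite expr1 (_ : slot Q' B' f' j = B' i'); last by rewrite ji' slot_in.
  rewrite [_ * fine (nu (B' _))]mulrC.
  apply: le_trans (_ : fine (nu (B' i')) <= _).
    by apply: le_nu => //; apply: measurableI => //; exact: measurableC.
  exact: (disj_le _ (B i')).
rewrite expr0 mulr1 slot_out// -setCU !nuC//; last exact: measurableU.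
rewrite measureU// fineD ?fin_num_measure//.
have := mulr_ge0 (fine_ge0 (measure_ge0 nu Q)) (fine_ge0 (measure_ge0 nu Q')).
nra.
Qed.

(** The second moment inequality for the hits (m, f).  The diagonal pairs sum
    to the expected number c of hits, the other pairs to at most
    c^2 (1 - p)^(-2k).  The number of injections f is the falling factorial. *)
Lemma prob_no_hit (M : nat) (Q : 'I_M -> set U) (B : 'I_M -> 'I_k -> set U)
    (p b : R) :
  (forall m, measurable (Q m)) -> (forall m i, measurable (B m i)) ->
  (forall m i, B m i `<=` Q m) ->
  (forall m i i', i != i' -> B m i `&` B m i' = set0) ->
  (forall m m', m != m' -> Q m `&` Q m' = set0) ->
  0 <= p < 1 -> 0 < b ->
  (forall m, fine (nu (Q m)) <= p) -> (forall m i, b <= fine (nu (B m i))) ->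
  (0 < M)%N -> (k <= n)%N ->
  fine (Pr (~` \bigcup_(mf : 'I_M * {f : {ffun 'I_k -> 'I_n} | injectiveb f})
                 hit X (Q mf.1) (B mf.1) (val mf.2))) <=
  (M%:R * ((n ^_ k)%:R * (b ^+ k * (1 - p) ^+ n)))^-1 +
  (1 - p)^-1 ^+ (2 * k) - 1.
Proof.
move=> mQ mB BQ Bdisj Qdisj /andP[p0 p1] b0 Qp bB M0 kn.
set J := ('I_M * _)%type; set w := _ ^+ (2 * k); set c0 := M%:R * _.
pose A (mf : J) := hit X (Q mf.1) (B mf.1) (val mf.2).
have mA mf : measurable (A mf) by exact: measurable_hit.
have inj (mf : J) : injective (val mf.2) by apply/injectiveP; exact: (valP mf.2).
have w0 : 0 <= w by rewrite exprn_ge0// invr_ge0 subr_ge0 ltW.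
have c0_gt0 : 0 < c0.
  rewrite mulr_gt0 ?ltr0n// mulr_gt0 ?ltr0n ?ffact_gt0//.
  by rewrite mulr_gt0 ?exprn_gt0// subr_gt0.
have := second_moment Pr mA; set s := \sum_i \sum_j _; set c := \sum_i _.
(* c0 is the number of pairs (m, f) times the lower bound of [prob_hit_ge] *)
have c0c : c0 <= c.
  rewrite /c /c0.
  have -> : M%:R * ((n ^_ k)%:R * (b ^+ k * (1 - p) ^+ n)) =
      \sum_(mf : J) b ^+ k * (1 - p) ^+ n :> R.
    rewrite sumr_const card_prod card_ord card_sig.
    rewrite -[in LHS](card_ord n) -[in X in (_ ^_ X)](card_ord k) -card_inj_ffuns.
    by rewrite -[RHS]mulr_natl natrM mulrA cardsE card_ord.
  apply: ler_sum => mf _; apply: prob_hit_ge => //; last exact: ltW.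
  by rewrite p0 ltW.
have sc : s <= c + c ^+ 2 * w.
  rewrite /s expr2 mulr_suml mulr_suml -big_split/=; apply: ler_sum => mf _.
  rewrite mulr_sumr mulr_suml [X in _ <= X + _](_ : _ =
      \sum_(mf' : J) if mf' == mf then fine (Pr (A mf)) else 0); last first.
    by rewrite -big_mkcond big_pred1_eq.
  rewrite -big_split/=; apply: ler_sum => mf' _.
  have AA0 : 0 <= fine (Pr (A mf)) * fine (Pr (A mf')) * w.
    by rewrite !mulr_ge0 ?fine_ge0.
  have [->|ne] := eqVneq mf' mf; first by rewrite setIid lerDl !mulr_ge0 ?fine_ge0.
  rewrite add0r; have [m_eq|m_ne] := eqVneq mf.1 mf'.1; last first.
    by apply: prob_hitI_le => //; exact: Qdisj.
  rewrite {1}/A {1}/A m_eq hit_disjoint ?measure0//; first exact: Bdisj.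
  apply: contra_neq ne => /val_inj e.
  by case: mf mf' m_eq e {AA0} => [? ?] [? ?] /= -> ->.
move=> H; have c_gt0 : 0 < c by exact: lt_le_trans c0c.
have : fine (Pr (~` \bigcup_mf A mf)) <= c^-1 + w - 1.
  rewrite -(ler_pM2r (exprn_gt0 2 c_gt0)) (le_trans H)//.
  rewrite !mulrDl [c^-1 * _]mulrA expr2 mulrA mulVf ?gt_eqF// mul1r.
  by move: sc; rewrite expr2; lra.
move=> /le_trans; apply; rewrite lerD2r lerD2r.
by rewrite lef_pV2 ?posrE.
Qed.
End Patterns.

(** * Orientations and order types *)

Section Geometry.
Context (R : realType).
Implicit Types (p q r x y z o u c : R * R) (A B : set (R * R)) (h s t e : R).

Definition det3 p q r : R :=
  (q.1 - p.1) * (r.2 - p.2) - (q.2 - p.2) * (r.1 - p.1).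

Lemma collinear_det p q r : collinear p q r -> det3 p q r = 0.
Proof.
move=> [a [b [c0 [ab0 H]]]].
have Hp := H p (Or31 _ _ erefl); have Hq := H q (Or32 _ _ erefl).
have Hr := H r (Or33 _ _ erefl).
have H1 : a * (q.1 - p.1) + b * (q.2 - p.2) = 0 by lra.
have H2 : a * (r.1 - p.1) + b * (r.2 - p.2) = 0 by lra.
have Ha : a * det3 p q r = 0.
  rewrite (_ : _ * _ = (a * (q.1 - p.1) + b * (q.2 - p.2)) * (r.2 - p.2) -
    (a * (r.1 - p.1) + b * (r.2 - p.2)) * (q.2 - p.2)); last by rewrite /det3; ring.
  by rewrite H1 H2 !mul0r subr0.
have Hb : b * det3 p q r = 0.
  rewrite (_ : _ * _ = (a * (r.1 - p.1) + b * (r.2 - p.2)) * (q.1 - p.1) -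
    (a * (q.1 - p.1) + b * (q.2 - p.2)) * (r.1 - p.1)); last by rewrite /det3; ring.
  by rewrite H1 H2 !mul0r subr0.
apply/eqP; move/eqP: Ha; move/eqP: Hb; rewrite !mulf_eq0.
case/orP => // /eqP b0; case/orP => // /eqP a0.
by case: ab0; rewrite a0 b0.
Qed.

Lemma det_collinear p q r : p <> q -> det3 p q r = 0 -> collinear p q r.
Proof.
move=> pq D0; exists (- (q.2 - p.2)), (q.1 - p.1).
exists (- (q.2 - p.2) * p.1 + (q.1 - p.1) * p.2); split.
  move=> [e1 e2]; apply: pq; case: p q e1 e2 {D0} => [p1 p2] [q1 q2] /= e1 e2.
  by congr pair; lra.
by move: D0; rewrite /det3 => D0 x [] ->; lra.
Qed.

Lemma orientation_eq0 p q r : (orientation p q r == 0) = (det3 p q r == 0).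
Proof. by rewrite /orientation sgr_eq0. Qed.

Lemma orientationC p q r : orientation q p r = - orientation p q r.
Proof. by rewrite /orientation -sgrN; congr Num.sg; ring. Qed.

Lemma orientation_rot p q r : orientation q r p = orientation p q r.
Proof. by rewrite /orientation; congr Num.sg; ring. Qed.

(** [same_type] compares increasing triples only; the orientation is
    alternating, so that all the triples of distinct indices agree. *)
Lemma same_orientation_all k (a b : 'I_k -> R * R) :
  (forall h i j : 'I_k, (h < i)%N -> (i < j)%N ->
    orientation (a h) (a i) (a j) = orientation (b h) (b i) (b j)) ->
  forall h i j : 'I_k, h != i -> i != j -> h != j ->
    orientation (a h) (a i) (a j) = orientation (b h) (b i) (b j).
Proof.
move=> H.
have lt_ne (i j : 'I_k) : i != j -> (i < j)%N || (j < i)%N by rewrite -neq_ltn.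
have H2 (h i j : 'I_k) : (h < i)%N -> h != j -> i != j ->
    orientation (a h) (a i) (a j) = orientation (b h) (b i) (b j).
  move=> hi hj ij; have [ij'|ji] := orP (lt_ne _ _ ij); first exact: H.
  have [hj'|jh] := orP (lt_ne _ _ hj); last first.
    by rewrite (orientation_rot (a j)) (orientation_rot (b j)) H.
  rewrite (orientation_rot (a j)) (orientation_rot (b j)).
  by rewrite (orientationC (a h)) (orientationC (b h)) H.
move=> h i j hi ij hj; have [hi'|ih] := orP (lt_ne _ _ hi); first exact: H2.
by rewrite orientationC H2 -?orientationC// eq_sym.
Qed.

Lemma general_position_orientation k (a : 'I_k -> R * R) :
  injective a ->
  general_position (range a) <->
  (forall h i j : 'I_k, h != i -> i != j -> h != j ->
    orientation (a h) (a i) (a j) <> 0).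
Proof.
move=> a_inj; split => [gp h i j hi ij hj|H p q r [h _ <-] [i _ <-] [j _ <-] pq qr pr].
  move=> /eqP; rewrite orientation_eq0 => /eqP D.
  have ne (l m : 'I_k) : l != m -> a l <> a m by move=> /eqP lm /a_inj.
  apply: (gp (a h) (a i) (a j)) => //; try exact: ne.
  by apply: det_collinear => //; exact: ne.
move=> /collinear_det/eqP; rewrite -orientation_eq0; apply/negP/eqP; apply: H;
  by apply/eqP => e; rewrite e in pq qr pr.
Qed.

(** Finiteness, and the general position of the second set, follow from the
    enumerations and from the general position of the first. *)
Lemma same_typeP A B : same_type A B <->
  general_position A /\ exists k (a b : 'I_k -> R * R),
      [/\ injective a, injective b, range a = A, range b = B &
        forall h i j : 'I_k, (h < i)%N -> (i < j)%N ->
          orientation (a h) (a i) (a j) = orientation (b h) (b i) (b j)].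
Proof.
split => [[_ _ gpA _ H]//|[gpA [k [a [b [a_inj b_inj aA bB H]]]]]].
have fin (f : 'I_k -> R * R) : finite_set (range f).
  exact/finite_image/finite_finset.
split; rewrite -?aA -?bB//; [by rewrite aA| |by exists k, a, b].
apply/general_position_orientation => // h i j hi ij hj.
rewrite -(same_orientation_all H)//.
by move: gpA; rewrite -aA => /general_position_orientation; apply.
Qed.

Lemma finite_set_enum A : finite_set A ->
  exists k (a : 'I_k -> R * R), injective a /\ range a = A.
Proof.
move=> /finite_seqP[s ->]; exists (size (undup s)), (tnth (in_tuple (undup s))); split.
  by move=> i j; apply/tuple_uniqP/undup_uniq.
apply/seteqP; split => [x [i _ <-]|x] /=; first by rewrite -mem_undup mem_tnth.
by rewrite -mem_undup => /(tnthP (in_tuple _))[i ->]; exists i.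
Qed.

(** * Rotated frames *)

(** The coordinates that define [grid_square]. *)
Definition frame o u x : R * R :=
  ((x.1 - o.1) * u.1 + (x.2 - o.2) * u.2,
   (x.2 - o.2) * u.1 - (x.1 - o.1) * u.2).

Definition unframe o u (s : R * R) : R * R :=
  (o.1 + s.1 * u.1 - s.2 * u.2, o.2 + s.1 * u.2 + s.2 * u.1).

(** Closed balls of the sup norm: axis-parallel squares of side 2e. *)
Definition box c e : set (R * R) :=
  [set x | `|x.1 - c.1| <= e /\ `|x.2 - c.2| <= e].

Lemma unframeK o u (s : R * R) : u.1 ^+ 2 + u.2 ^+ 2 = 1 -> frame o u (unframe o u s) = s.
Proof.
move=> u1; rewrite /frame /unframe [RHS]surjective_pairing /=; congr pair.
  by transitivity (s.1 * (u.1 ^+ 2 + u.2 ^+ 2)); [ring | rewrite u1 mulr1].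
by transitivity (s.2 * (u.1 ^+ 2 + u.2 ^+ 2)); [ring | rewrite u1 mulr1].
Qed.

Lemma unit_le1 u : u.1 ^+ 2 + u.2 ^+ 2 = 1 -> `|u.1| <= 1 /\ `|u.2| <= 1.
Proof.
move=> u1; have := sqr_ge0 u.1; have := sqr_ge0 u.2.
by split; rewrite -(expr_le1 (n := 2))// real_normK ?num_real//; lra.
Qed.

Lemma norm_comb_le (a b v w s t : R) : `|v| <= 1 -> `|w| <= 1 ->
  `|a| <= s -> `|b| <= t -> `|a * v + b * w| <= s + t.
Proof.
move=> v1 w1 as_ bt; apply: le_trans (ler_normD _ _) _; rewrite !normrM.
by apply: lerD; [apply: le_trans as_|apply: le_trans bt]; rewrite ler_piMr.
Qed.

(** A rotation is sqrt(2)-Lipschitz for the sup norm; the factor 2 is enough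
    below. *)
Lemma frame_box o u x c e : u.1 ^+ 2 + u.2 ^+ 2 = 1 ->
  box c e x -> box (frame o u c) (2 * e) (frame o u x).
Proof.
move=> /unit_le1[v1 w1] [x1 x2]; rewrite /box /= (_ : 2 * e = e + e); last by ring.
split.
  by rewrite (_ : _ - _ = (x.1 - c.1) * u.1 + (x.2 - c.2) * u.2);
    [exact: norm_comb_le|ring].
rewrite (_ : _ - _ = (x.2 - c.2) * u.1 + (x.1 - c.1) * - u.2); last by ring.
by apply: norm_comb_le; rewrite ?normrN.
Qed.

Lemma box_frame o u x c s t : u.1 ^+ 2 + u.2 ^+ 2 = 1 ->
  `|(frame o u x).1 - (frame o u c).1| <= s ->
  `|(frame o u x).2 - (frame o u c).2| <= t -> box c (s + t) x.
Proof.
move=> u1 xs xt; have [v1 w1] := unit_le1 u1; split.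
  rewrite (_ : _ - _ = ((frame o u x).1 - (frame o u c).1) * u.1 +
    ((frame o u x).2 - (frame o u c).2) * - u.2).
    by apply: norm_comb_le; rewrite ?normrN.
  by transitivity ((x.1 - c.1) * (u.1 ^+ 2 + u.2 ^+ 2));
    [rewrite u1 mulr1|rewrite /=; ring].
rewrite (_ : _ - _ = ((frame o u x).1 - (frame o u c).1) * u.2 +
    ((frame o u x).2 - (frame o u c).2) * u.1); first exact: norm_comb_le.
by transitivity ((x.2 - c.2) * (u.1 ^+ 2 + u.2 ^+ 2));
    [rewrite u1 mulr1|rewrite /=; ring].
Qed.

Lemma orientation_frame o u p q r : u.1 ^+ 2 + u.2 ^+ 2 = 1 ->
  orientation (frame o u p) (frame o u q) (frame o u r) = orientation p q r.
Proof.
move=> u1; rewrite /orientation; congr Num.sg; rewrite /=.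
rewrite -[RHS]mulr1 -u1; ring.
Qed.

Lemma orientation_homothety (k : R) c p q r : 0 < k ->
  orientation (c.1 + k * p.1, c.2 + k * p.2) (c.1 + k * q.1, c.2 + k * q.2)
    (c.1 + k * r.1, c.2 + k * r.2) = orientation p q r.
Proof.
move=> k0; rewrite /orientation /=.
rewrite (_ : _ - _ = k ^+ 2 * ((q.1 - p.1) * (r.2 - p.2) - (q.2 - p.2) * (r.1 - p.1)));
  last by ring.
by rewrite sgrM gtr0_sg ?mul1r// exprn_gt0.
Qed.


(** * Stability of an order type under perturbation *)

Lemma sgr_close (x y : R) : `|x - y| < `|y| -> Num.sg x = Num.sg y.
Proof.
have [y0|y0|->] := ltgtP y 0; last by rewrite normr0 ltNge normr_ge0.
  rewrite (ltr0_norm y0) ltr_norml => /andP[_ ?].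
  by rewrite !ltr0_sg//; lra.
rewrite (gtr0_norm y0) ltr_norml => /andP[? _].
by rewrite !gtr0_sg//; lra.
Qed.

(** Moving three points by at most e < 1 changes the determinant by at most a
    constant times e, which cannot change the sign of a nonzero value. *)
Lemma orientation_stable p q r : orientation p q r <> 0 ->
  \forall e \near 0^'+, forall x y z, box p e x -> box q e y -> box r e z ->
    orientation x y z = orientation p q r.
Proof.
move=> /eqP; rewrite orientation_eq0 => D0.
pose S : R := `|q.1 - p.1| + `|r.2 - p.2| + `|q.2 - p.2| + `|r.1 - p.1|.
have S0 : 0 <= S by rewrite !addr_ge0.
near=> e => x y z [x1 x2] [y1 y2] [z1 z2].
have e0 : 0 < e by near: e; exact: nbhs_right_gt.
have e1 : e < 1 by near: e; exact: nbhs_right_lt.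
have eD : e * (2 * S + 8) < `|det3 p q r|.
  rewrite -ltr_pdivlMr; last lra.
  by near: e; apply: nbhs_right_lt; rewrite divr_gt0 ?normr_gt0//; lra.
rewrite /orientation; apply: sgr_close; apply: le_lt_trans eD.
have diff (a b a' b' : R) : `|a' - a| <= e -> `|b' - b| <= e ->
    `|(b' - a') - (b - a)| <= 2 * e.
  by rewrite !ler_norml => /andP[? ?] /andP[? ?]; apply/andP; split; lra.
have mul (a b a' b' : R) : `|a' - a| <= 2 * e -> `|b' - b| <= 2 * e ->
    `|a' * b' - a * b| <= 2 * e * (`|a| + `|b|) + 4 * e.
  move=> ha hb; rewrite (_ : _ - _ =
    (a' - a) * b + (a * (b' - b) + (a' - a) * (b' - b))); last by ring.
  apply: le_trans (ler_normD _ _) _.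
  apply: le_trans (lerD (lexx _) (ler_normD _ _)) _; rewrite !normrM.
  have : `|a' - a| * `|b| <= 2 * e * `|b| by rewrite ler_wpM2r.
  have : `|a| * `|b' - b| <= `|a| * (2 * e) by rewrite ler_wpM2l.
  have : `|a' - a| * `|b' - b| <= (2 * e) * (2 * e) by rewrite ler_pM.
  have : e * e <= e by rewrite ger_pMr// ltW.
  by move=> *; lra.
have m1 := mul _ _ _ _ (diff _ _ _ _ x1 y1) (diff _ _ _ _ x2 z2).
have m2 := mul _ _ _ _ (diff _ _ _ _ x2 y2) (diff _ _ _ _ x1 z1).
rewrite (_ : _ - _ = ((y.1 - x.1) * (z.2 - x.2) - (q.1 - p.1) * (r.2 - p.2)) -
  ((y.2 - x.2) * (z.1 - x.1) - (q.2 - p.2) * (r.1 - p.1))); last by ring.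
apply: le_trans (ler_normB _ _) _; apply: le_trans (lerD m1 m2) _.
by rewrite /S; lra.
Unshelve. all: by end_near. Qed.

Lemma box_separated p q : p <> q ->
  \forall e \near 0^'+, box p e `&` box q e = set0.
Proof.
move=> pq; pose D : R := `|p.1 - q.1| + `|p.2 - q.2|.
have D0 : 0 < D.
  rewrite lt_neqAle addr_ge0// andbT eq_sym paddr_eq0// !normr_eq0 !subr_eq0.
  apply/negP => /andP[/eqP e1 /eqP e2]; apply: pq.
  by case: p q e1 e2 {D} => [? ?] [? ?] /= -> ->.
near=> e; rewrite -subset0 => x [[x1 x2] [y1 y2]].
have : e < D / 4 by near: e; apply: nbhs_right_lt; rewrite divr_gt0.
have := ler_distD x.1 p.1 q.1; have := ler_distD x.2 p.2 q.2.
by move: x1 x2; rewrite -!(distrC p.1) -!(distrC p.2) /D => *; clear pq; lra.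
Unshelve. all: by end_near. Qed.

(** The condition that the boxes are disjoint gives the injectivity of the
    perturbed enumeration, which the orientations alone do not give when there
    are only two points. *)
Lemma type_stable k (a : 'I_k -> R * R) : injective a ->
  general_position (range a) ->
  exists2 e, 0 < e &
    (forall i j, i != j -> box (a i) e `&` box (a j) e = set0) /\
    (forall b : 'I_k -> R * R, (forall i, box (a i) e (b i)) ->
      forall h i j : 'I_k, (h < i)%N -> (i < j)%N ->
        orientation (a h) (a i) (a j) = orientation (b h) (b i) (b j)).
Proof.
move=> a_inj /(general_position_orientation a_inj) gp.
have H1 : \forall e \near 0^'+, forall ij : 'I_k * 'I_k, ij.1 != ij.2 ->
    box (a ij.1) e `&` box (a ij.2) e = set0.
  apply: filter_forall => -[i j]; have [->|ij] := eqVneq i j.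
    by apply: nearW => e /eqP.
  have /box_separated : a i <> a j by move=> /a_inj; exact/eqP.
  by apply: filterS.
have H2 : \forall e \near 0^'+, forall hij : 'I_k * 'I_k * 'I_k,
    (hij.1.1 < hij.1.2)%N -> (hij.1.2 < hij.2)%N -> forall x y z,
    box (a hij.1.1) e x -> box (a hij.1.2) e y -> box (a hij.2) e z ->
    orientation x y z = orientation (a hij.1.1) (a hij.1.2) (a hij.2).
  apply: filter_forall => -[[h i] j] /=.
  have [hi|/negP nhi] := boolP (h < i)%N; last by apply: nearW.
  have [ij|/negP nij] := boolP (i < j)%N; last by apply: nearW.
  have /orientation_stable : orientation (a h) (a i) (a j) <> 0.
    by apply: gp; rewrite neq_ltn ?hi ?ij// (ltn_trans hi ij).
  by apply: filterS => e H _ _ x y z; exact: H.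
near (0 : R)^'+ => e.
have E1 := near H1 e; have E2 := near H2 e.
exists e; first by near: e; exact: nbhs_right_gt.
split => [i j ij|b ab h i j hi ij]; first exact: (E1 _ (i, j)).
by apply/esym; apply: (E2 _ (h, i, j)).
Unshelve. all: by end_near. Qed.
End Geometry.

(** * Measurability of the event *)

Section Measurability.
Context (R : realType) (d : measure_display) (T : measurableType d).

Lemma measurable_forall (I : finType) (P : I -> T -> Prop) :
  (forall i, measurable [set w | P i w]) -> measurable [set w | forall i, P i w].
Proof.
move=> mP; rewrite (_ : [set w | _] = \bigcap_i [set w | P i w]).
  by apply: fin_bigcap_measurable => //; exact: finite_finset.
by apply/seteqP; split => w /= H i //=; exact: H.
Qed.

Lemma measurable_exists (I : countType) (P : I -> T -> Prop) :
  (forall i, measurable [set w | P i w]) -> measurable [set w | exists i, P i w].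
Proof.
move=> mP; rewrite (_ : [set w | _] = \bigcup_i [set w | P i w]).
  exact: countable_bigcupT_measurable.
by apply/seteqP; split => w /= [i]; [move=> H; exists i|move=> _ H; exists i].
Qed.

Lemma measurable_and (P Q : T -> Prop) : measurable [set w | P w] ->
  measurable [set w | Q w] -> measurable [set w | P w /\ Q w].
Proof. exact: measurableI. Qed.

Lemma measurable_not (P : T -> Prop) : measurable [set w | P w] ->
  measurable [set w | ~ P w].
Proof. exact: measurableC. Qed.

Lemma measurable_implies (P Q : T -> Prop) : measurable [set w | P w] ->
  measurable [set w | Q w] -> measurable [set w | P w -> Q w].
Proof.
move=> mP mQ; rewrite (_ : [set w | _] = ~` [set w | P w] `|` [set w | Q w]).
  by apply: measurableU => //; exact: measurableC.
apply/seteqP; split => w /=; last by case.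
by move=> H; have [p|np] := pselect (P w); [right; exact: H|left].
Qed.

Lemma measurable_cst_prop (P : Prop) : measurable [set w : T | P].
Proof.
have [p|np] := pselect P.
  by rewrite (_ : [set w | _] = setT)//; apply/seteqP; split.
by rewrite (_ : [set w | _] = set0)//; apply/seteqP; split.
Qed.

Lemma measurable_sg (f : T -> R) (c : R) : measurable_fun setT f ->
  measurable [set w | Num.sg (f w) = c].
Proof.
move=> mf; rewrite (_ : [set w | _] = f @^-1` [set x | Num.sg x = c])//.
rewrite -[X in measurable X]setTI; apply: mf => //.
have [->|c1] := eqVneq c 1.
  rewrite (_ : [set x | _] = `]0, +oo[%classic); first exact: measurable_itv.
  apply/seteqP; split => x /=; rewrite in_itv/= andbT.
    by move/eqP; rewrite sgr_cp0.
  by move=> ?; rewrite gtr0_sg.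
have [->|c0] := eqVneq c 0.
  rewrite (_ : [set x | _] = [set 0]); first exact: measurable_set1.
  apply/seteqP; split => x /=; last by move=> ->; rewrite sgr0.
  by move/eqP; rewrite sgr_eq0 => /eqP.
have [->|cN1] := eqVneq c (-1).
  rewrite (_ : [set x | _] = `]-oo, 0[%classic); first exact: measurable_itv.
  apply/seteqP; split => x /=; rewrite in_itv/=.
    by move/eqP; rewrite sgr_cp0.
  by move=> ?; rewrite ltr0_sg.
rewrite (_ : [set x | _] = set0)// -subset0 => x /= xc.
by move: c1 c0 cN1; rewrite -xc; case: sgrP; rewrite eqxx.
Qed.

Lemma measurable_eq0 (f : T -> R) : measurable_fun setT f ->
  measurable [set w | f w = 0].
Proof.
move=> mf; rewrite (_ : [set w | _] = setT `&` f @^-1` [set 0]); last by rewrite setTI.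
by apply: mf => //; exact: measurable_set1.
Qed.

(** Fix an enumeration a0 of A.  Any enumeration of A is a0 \o s for some finite
    function s, and any enumeration of the sample points in Q is given by a
    finite function f to the indices of the sample.  This turns the existence
    of k and of two enumerations into a countable union. *)
Lemma measurable_same_type (n : nat) (X : 'I_n -> T -> borel_plane R)
    (A Q : set (R * R)) :
  (forall j, measurable_fun setT (X j)) -> measurable (Q : set (borel_plane R)) ->
  measurable [set w | same_type A (range (fun j => X j w : R * R) `&` Q)].
Proof.
move=> mX mQ.
have [[finA gpA]|nA] := pselect (finite_set A /\ general_position A); last first.
  rewrite (_ : [set w | _] = set0)// -subset0 => w /= /same_typeP[gpA [k [a [b [_ _ aA _ _]]]]].
  by apply: nA; split => //; rewrite -aA; exact/finite_image/finite_finset.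
have [k0 [a0 [a0_inj a0A]]] := finite_set_enum finA.
have mQX j : measurable [set w | Q (X j w)].
  by rewrite -[X in measurable X]setTI; exact: mX.
have mX1 j : measurable_fun setT (fun w => (X j w).1 : R).
  exact: (measurableT_comp measurable_fst (mX j)).
have mX2 j : measurable_fun setT (fun w => (X j w).2 : R).
  exact: (measurableT_comp measurable_snd (mX j)).
have meq i j : measurable [set w | X i w = X j w].
  rewrite (_ : [set w | _] = [set w | (X i w).1 - (X j w).1 = 0 /\
                                      (X i w).2 - (X j w).2 = 0]).
    by apply: measurable_and; apply: measurable_eq0; exact: measurable_funB.
  apply/seteqP; split => w /=; first by move=> ->; rewrite !subrr.
  move=> [/eqP e1 /eqP e2]; move: e1 e2; rewrite !subr_eq0 => /eqP e1 /eqP e2.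
  by rewrite (surjective_pairing (X i w)) e1 e2 -surjective_pairing.
have mor h i j c : measurable [set w | c = orientation (X h w) (X i w) (X j w)].
  rewrite (_ : [set w | _] = [set w | orientation (X h w) (X i w) (X j w) = c]).
    apply: measurable_sg; apply: measurable_funB; apply: measurable_funM;
      exact: measurable_funB.
  by apply/seteqP; split.
pose E k (sf : {ffun 'I_k -> 'I_k0} * {ffun 'I_k -> 'I_n}) w :=
  (injective (a0 \o sf.1) /\ range (a0 \o sf.1) = A) /\
  ((forall i j : 'I_k, i <> j -> ~ X (sf.2 i) w = X (sf.2 j) w) /\
   (forall i, Q (X (sf.2 i) w)) /\
   (forall j, Q (X j w) -> exists i, X (sf.2 i) w = X j w)) /\
  (forall h i j : 'I_k, (h < i)%N -> (i < j)%N ->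
     orientation (a0 (sf.1 h)) (a0 (sf.1 i)) (a0 (sf.1 j)) =
     orientation (X (sf.2 h) w) (X (sf.2 i) w) (X (sf.2 j) w)).
rewrite (_ : [set w | _] = [set w | exists k, exists sf, @E k sf w]).
  apply: measurable_exists => k; apply: measurable_exists => sf.
  apply: measurable_and; first exact: measurable_cst_prop.
  apply: measurable_and; last first.
    do 3 (apply: measurable_forall => ?).
    by do 2 (apply: measurable_implies; first exact: measurable_cst_prop).
  apply: measurable_and.
    do 2 (apply: measurable_forall => ?); apply: measurable_implies.
      exact: measurable_cst_prop.
    exact: measurable_not.
  apply: measurable_and; first exact: measurable_forall.
  apply: measurable_forall => j; apply: measurable_implies => //.
  exact: measurable_exists.
apply/seteqP; split => w /=.
  move=> /same_typeP[_ [k [a [b [a_inj b_inj aA bB H]]]]]; exists k.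
  have /choice[s sP] : forall i, exists l, a0 l = a i.
    move=> i; have : A (a i) by rewrite -aA; exists i.
    by rewrite -a0A => -[l _ <-]; exists l.
  have /choice[f fP] : forall i, exists l, X l w = b i.
    move=> i; have : (range (fun j => X j w : R * R) `&` Q) (b i) by rewrite -bB; exists i.
    by move=> [[l _ <-] _]; exists l.
  exists (finfun s, finfun f); have as_ : a0 \o finfun s = a.
    by apply/funext => i /=; rewrite ffunE sP.
  split; first by rewrite as_.
  split; last by move=> h i j hi ij; rewrite !ffunE !sP !fP H.
  split; first by move=> i j ij; rewrite /= !ffunE !fP => /b_inj.
  split => [i|j Qj].
    rewrite /= ffunE fP.
    by have : range b (b i) by []; rewrite bB => -[].
  have : (range (fun j => X j w : R * R) `&` Q) (X j w) by split => //; exists j.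
  by rewrite -bB => -[i _ <-]; exists i; rewrite ffunE fP.
move=> [k [[s f] [[a_inj aA] [[b_inj [bQ Qb]] H]]]]; apply/same_typeP; split => //.
exists k, (a0 \o s), (fun i => X (f i) w); split => //.
  by move=> i j ij; apply: contrapT => /b_inj.
apply/seteqP; split => [x [i _ <-]|x [[j _ <-] /Qb[i <-]]].
  by split; [exists (f i)|exact: bQ].
by exists i.
Qed.
End Measurability.

(** * Copies of a pattern in the cells of a grid *)

Section Cells.
Context (R : realType).
Implicit Types (o u c : R * R) (h l e : R).

Definition cell_center h (i j : int) : R * R :=
  ((i%:~R + 2^-1) * h, (j%:~R + 2^-1) * h).

(** Coordinates in which the cell (i, j) is the square of center 0 and side
    1/l, so that a configuration of any size is brought inside the cell by
    taking l small.  The point of coordinates p is [cell_point]. *)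
Definition cell_coord o u h l i j (x : R * R) : R * R :=
  (((frame o u x).1 - (cell_center h i j).1) / (l * h),
   ((frame o u x).2 - (cell_center h i j).2) / (l * h)).

Definition cell_point o u h l i j (p : R * R) : R * R :=
  unframe o u ((cell_center h i j).1 + l * h * p.1,
               (cell_center h i j).2 + l * h * p.2).

Lemma grid_squareE o u h i j x : grid_square h o u i j x <->
  box (cell_center h i j) (h / 2) (frame o u x).
Proof.
rewrite /grid_square /box /cell_center /frame /= !intrD !ler_norml.
by split => -[/andP[? ?] /andP[? ?]]; split; apply/andP; split; lra.
Qed.

(** Boxes of the plane and boxes in cell coordinates have different axes: the
    factor 2 lost in [frame_box] is the reason for the half on the left. *)
Lemma cell_coord_box o u h l i j p e x : u.1 ^+ 2 + u.2 ^+ 2 = 1 ->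
  0 < h -> 0 < l ->
  box (cell_point o u h l i j p) (l * e / 2 * h) x ->
  box p e (cell_coord o u h l i j x).
Proof.
move=> u1 h0 l0 /(frame_box o u1); rewrite /cell_point unframeK//.
have lh : 0 < l * h by rewrite mulr_gt0.
have aux (s z q : R) : `|s - (z + l * h * q)| <= 2 * (l * e / 2 * h) ->
    `|(s - z) / (l * h) - q| <= e.
  move=> H; rewrite -(ler_pM2r lh) -[X in _ * X](gtr0_norm lh) -normrM.
  rewrite mulrBl divfK ?gt_eqF//; apply: le_trans (le_trans H _).
    by rewrite le_eqVlt; apply/orP; left; apply/eqP; congr `|_|; ring.
  by rewrite le_eqVlt; apply/orP; left; apply/eqP; field.
by move=> [/aux H1 /aux H2].
Qed.

Lemma orientation_cell_coord o u h l i j p q r : u.1 ^+ 2 + u.2 ^+ 2 = 1 ->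
  0 < h -> 0 < l ->
  orientation (cell_coord o u h l i j p) (cell_coord o u h l i j q)
    (cell_coord o u h l i j r) = orientation p q r.
Proof.
move=> u1 h0 l0; have lh : 0 < l * h by rewrite mulr_gt0.
rewrite -[RHS](orientation_frame o _ _ _ u1).
rewrite -[LHS](orientation_homothety (cell_center h i j) _ _ _ lh).
have aux x : ((cell_center h i j).1 + l * h * (cell_coord o u h l i j x).1,
    (cell_center h i j).2 + l * h * (cell_coord o u h l i j x).2) = frame o u x.
  have cancel (z s : R) : z + l * h * ((s - z) / (l * h)) = s.
    by rewrite mulrC divfK ?gt_eqF//; ring.
  by rewrite [RHS]surjective_pairing; congr pair; exact: cancel.
by rewrite !aux.
Qed.

Lemma grid_square_disjoint o u h (i i' j : int) : 0 < h -> i + 1 < i' ->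
  grid_square h o u i j `&` grid_square h o u i' j = set0.
Proof.
move=> h0 ii'; rewrite -subset0 => x [[/andP[_ H1] _] [/andP[H2 _] _]].
have := le_trans H2 H1; rewrite ler_pM2r// ler_int leNgt.
by rewrite ii'.
Qed.

Lemma measurable_grid_square o u h i j :
  measurable (grid_square h o u i j : set (borel_plane R)).
Proof.
pose s (x : borel_plane R) : R := (x.1 - o.1) * u.1 + (x.2 - o.2) * u.2.
pose t (x : borel_plane R) : R := (x.2 - o.2) * u.1 - (x.1 - o.1) * u.2.
have m1 : measurable_fun setT (fun x : borel_plane R => x.1 : R).
  exact: measurable_fst.
have m2 : measurable_fun setT (fun x : borel_plane R => x.2 : R).
  exact: measurable_snd.
have mB1 := measurable_funB m1 (measurable_cst o.1).
have mB2 := measurable_funB m2 (measurable_cst o.2).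
have ms : measurable_fun setT s.
  exact: (measurable_funD (measurable_funM mB1 (measurable_cst u.1))
    (measurable_funM mB2 (measurable_cst u.2))).
have mt : measurable_fun setT t.
  exact: (measurable_funB (measurable_funM mB2 (measurable_cst u.1))
    (measurable_funM mB1 (measurable_cst u.2))).
rewrite (_ : grid_square _ _ _ _ _ =
  (s @^-1` `[i%:~R * h, (i + 1)%:~R * h]) `&`
  (t @^-1` `[j%:~R * h, (j + 1)%:~R * h])); last first.
  by apply/seteqP; split => x; rewrite /grid_square /= !in_itv.
apply: measurableI.
  rewrite -[X in measurable X]setTI; apply: ms => //; exact: measurable_itv.
by rewrite -[X in measurable X]setTI; apply: mt => //; exact: measurable_itv.
Qed.

(** The squares Q m are taken in one row of the grid, starting from the cell
    that contains c and skipping every other cell: closed neighbouring cells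
    share an edge.  The constant rho depends on the configuration only, not
    on the grid, the mesh h or the number M of squares. *)
Lemma square_grid_patterns k (a : 'I_k -> R * R) : injective a ->
  general_position (range a) ->
  exists2 rho : R, 0 < rho & forall (M : nat) c h G, 0 < h -> square_grid h G ->
  exists (Q : 'I_M -> set (R * R)) (z : 'I_M -> R * R)
    (y : 'I_M -> 'I_k -> R * R),
  [/\ forall m, G (Q m),
      forall m, Q m `<=` box (z m) h /\ box (z m) h `<=` box c ((M%:R * 2 + 2) * h),
      forall m m', m != m' -> Q m `&` Q m' = set0,
      forall m i, box (y m i) (rho * h) `<=` Q m &
      forall m, (forall i i', i != i' ->
          box (y m i) (rho * h) `&` box (y m i') (rho * h) = set0) /\
        (forall b : 'I_k -> R * R, (forall i, box (y m i) (rho * h) (b i)) ->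
          forall h i j : 'I_k, (h < i)%N -> (i < j)%N ->
          orientation (a h) (a i) (a j) = orientation (b h) (b i) (b j))].
Proof.
move=> a_inj gp; have [e e0 [sep stab]] := type_stable a_inj gp.
pose L : R := e + \sum_i (`|(a i).1| + `|(a i).2|).
have S0 : 0 <= \sum_i (`|(a i).1| + `|(a i).2|).
  by apply: sumr_ge0 => i _; rewrite addr_ge0.
have L0 : 0 < L by rewrite /L; lra.
have aL i : `|(a i).1| + e <= L /\ `|(a i).2| + e <= L.
  have : `|(a i).1| + `|(a i).2| <= \sum_i (`|(a i).1| + `|(a i).2|).
    rewrite (bigD1 i)//= lerDl; apply: sumr_ge0 => j _; exact: addr_ge0.
  have := normr_ge0 (a i).1; have := normr_ge0 (a i).2.
  by rewrite /L => ? ? ?; split; lra.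
(* the boxes around the a_i lie in the box of half side L = 1 / (2 l) around 0 *)
pose l := (2 * L)^-1; have l0 : 0 < l by rewrite invr_gt0 mulr_gt0.
exists (l * e / 2); first by rewrite divr_gt0// mulr_gt0.
move=> M c h G h0 [] o [u [u1 ->]].
pose i0 := Num.floor ((frame o u c).1 / h).
pose j0 := Num.floor ((frame o u c).2 / h).
pose I (m : 'I_M) : int := i0 + (2 * m)%N%:Z.
exists (fun m => grid_square h o u (I m) j0).
exists (fun m => unframe o u (cell_center h (I m) j0)).
exists (fun m i => cell_point o u h l (I m) j0 (a i)).
have floor_h (s : R) : (Num.floor (s / h))%:~R * h <= s <
    ((Num.floor (s / h))%:~R + 1) * h.
  by rewrite -ler_pdivlMr// -ltr_pdivrMr// -(intrD _ _ 1) floor_itv.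
split.
- by move=> m; exists (I m), j0.
- move=> m; split.
    move=> x /grid_squareE[x1 x2]; rewrite [X in box _ X](splitr h).
    by apply: (box_frame (o := o) u1); rewrite unframeK.
  suff : box c ((M%:R * 2 + 1) * h) (unframe o u (cell_center h (I m) j0)).
    move=> [+ +] x [+ +]; set v := unframe _ _ _; rewrite /box /= !ler_norml.
    move=> /andP[? ?] /andP[? ?] /andP[? ?] /andP[? ?].
    by split; apply/andP; split; lra.
  rewrite mulrDl mul1r; apply: (box_frame (o := o) u1); rewrite unframeK//.
    have /andP[H1 H2] := floor_h (frame o u c).1.
    have mM : (m%:R + 1) * h <= M%:R * h :> R.
      by rewrite ler_pM2r// -[1]/(1%:R) -natrD ler_nat addn1.
    have m0 : 0 <= m%:R * h :> R by rewrite mulr_ge0// ltW.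
    rewrite /cell_center /I intrD -pmulrn natrM; move: H1 H2; rewrite -/i0.
    move: (frame o u c).1 => f1 H1 H2.
    by rewrite ler_norml; apply/andP; split; rewrite /=; lra.
  have /andP[H1 H2] := floor_h (frame o u c).2.
  rewrite /cell_center; move: H1 H2; rewrite -/j0.
  move: (frame o u c).2 => f2 H1 H2; rewrite ler_norml.
  by apply/andP; split; rewrite /=; lra.
- move=> m m'; wlog mm' : m m' / (m < m')%N.
    move=> H /[dup] ne; rewrite neq_ltn => /orP[mm'|m'm]; first exact: H.
    by rewrite setIC H// eq_sym.
  move=> _; apply: grid_square_disjoint => //.
  by rewrite /I -addrA ltrD2l -PoszD ltz_nat addn1 !mul2n ltn_Sdouble.
- move=> m i x /(cell_coord_box u1 h0 l0) [H1 H2]; apply/grid_squareE.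
  have aux (s z q : R) : `|q| + e <= L -> `|(s - z) / (l * h) - q| <= e ->
      `|s - z| <= h / 2.
    move=> qL H; have : `|(s - z) / (l * h)| <= L.
      rewrite -(subrK q (_ / _)); apply: le_trans (ler_normD _ _) _.
      by move: H qL; lra.
    rewrite normrM normfV (gtr0_norm (mulr_gt0 l0 h0)) ler_pdivrMr ?mulr_gt0//.
    by move=> /le_trans; apply; rewrite /l le_eqVlt; apply/orP; left; apply/eqP;
      field; rewrite gt_eqF.
  by have [aL1 aL2] := aL i; split; [exact: aux H1|exact: aux H2].
- move=> m; split.
    move=> i i' ii'; rewrite -subset0 => x [/(cell_coord_box u1 h0 l0) H1].
    move=> /(cell_coord_box u1 h0 l0) H2.
    by have := conj H1 H2; rewrite -[_ /\ _]/((_ `&` _) _) sep.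
  move=> b yb h' i j hi ij.
  rewrite (stab (fun i => cell_coord o u h l (I m) j0 (b i))) => [|i1||//]//.
    exact: orientation_cell_coord.
  exact: cell_coord_box (yb i1).
Qed.
End Cells.

(** * Elementary estimates *)

Lemma ge_bernoulli (R : realType) (x : R) (n : nat) :
  0 <= x <= 1 -> 1 - n%:R * x <= (1 - x) ^+ n.
Proof.
move=> /andP[x0 x1]; elim: n => [|n IH]; first by rewrite mul0r subr0 expr0.
rewrite exprS; apply: le_trans (_ : (1 - x) * (1 - n%:R * x) <= _).
  have : 0 <= n%:R * x * x by rewrite !mulr_ge0.
  by rewrite -natr1; lra.
by rewrite ler_wpM2l// subr_ge0.
Qed.

(** The expected number of hits of one square is bounded below independently of
    n: the falling factorial is at least (n/2)^k since 2 k <= n, and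
    1 - p >= exp (- 2 p) for p <= 1/2. *)
Lemma occupancy_ge (R : realType) (k n : nat) (g q : R) :
  0 < g -> 0 < q -> (0 < n)%N -> (2 * k <= n)%N -> 2 * q <= n%:R ->
  (g / 2) ^+ k * expR (- (2 * q)) <=
  (n ^_ k)%:R * ((g / n%:R) ^+ k * (1 - q / n%:R) ^+ n).
Proof.
move=> g0 q0 n0 kn qn; have n0' : 0 < n%:R :> R by rewrite ltr0n.
set p := q / n%:R.
have p0 : 0 < p by rewrite divr_gt0.
have p2 : p <= 2^-1 by rewrite ler_pdivrMr//; lra.
have expp : expR (- (2 * p)) <= 1 - p.
  rewrite expRN -[leRHS]invrK lef_pV2 ?posrE ?invr_gt0 ?expR_gt0//; last lra.
  apply: le_trans (expR_ge1Dx _); rewrite -[X in X <= _]mul1r ler_pdivrMr; last lra.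
  have : p * p <= p * 2^-1 by rewrite ler_pM2l.
  by lra.
rewrite mulrA; apply: ler_pM; rewrite ?exprn_ge0 ?expR_ge0//.
- by rewrite divr_ge0// ltW.
- rewrite ffact_prod natr_prod -[X in _ ^+ X]card_ord -prodr_const.
  rewrite -[X in (g / n%:R) ^+ X]card_ord -prodr_const -big_split/=.
  apply: ler_prod => i _; apply/andP; split; first by rewrite divr_ge0// ltW.
  rewrite mulrCA ler_pM2l// ler_pdivlMr// mulrC ler_pdivrMr//.
  have ik : (i <= k)%N by exact: ltnW.
  rewrite -natrM ler_nat; lia.
- have -> : - (2 * q) = n%:R * - (2 * p) :> R.
    by rewrite /p; field; rewrite gt_eqF.
  rewrite expRM_natl.
  by rewrite lerXn2r ?nnegrE ?expR_ge0//; lra.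
Qed.

Lemma invXn_le (R : realType) (x e : R) (m : nat) :
  0 <= x < 1 -> 0 < e -> m%:R * x * (1 + e) <= e -> (1 - x)^-1 ^+ m <= 1 + e.
Proof.
move=> /andP[x0 x1] e0 xe; rewrite exprVn -[leRHS]invrK.
have e1 : 0 < 1 + e by lra.
rewrite lef_pV2 ?posrE ?invr_gt0 ?exprn_gt0//; last by rewrite subr_gt0.
apply: le_trans (ge_bernoulli _ _); last by rewrite x0 ltW.
by rewrite -[X in X <= _]mul1r ler_pdivrMr//; lra.
Qed.


(** * The uniform law on boxes *)

Section Uniform.
Context (R : realType).

Lemma boxE (z : R * R) (e : R) : box z e =
  `[z.1 - e, z.1 + e]%classic `*` `[z.2 - e, z.2 + e]%classic.
Proof.
by apply/seteqP; split => x; rewrite /box /= !in_itv/= -!ler_distl.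
Qed.

Lemma measurable_box (z : R * R) (e : R) :
  measurable (box z e : set (borel_plane R)).
Proof. by rewrite boxE; apply: measurableX; exact: measurable_itv. Qed.

Lemma area_box (z : R * R) (e : R) : 0 < e ->
  area (box z e) = ((2 * e) ^+ 2)%:E.
Proof.
move=> e0; rewrite boxE /area product_measure1E; try exact: measurable_itv.
have len (x : R) : lebesgue_measure `[x - e, x + e]%classic = (2 * e)%:E.
  rewrite lebesgue_measure_itv/= lte_fin ifT; last lra.
  by rewrite -EFinB; congr _%:E; ring.
by rewrite expr2 EFinM; congr mule; exact: len.
Qed.

(** The normalization area C / area C = 1, the uniform law of the whole plane,
    already excludes the areas 0 and +oo. *)
Lemma area_support (C : set (R * R)) (d : measure_display)
    (T : measurableType d) (Pr : probability T R)
    (X : {RV Pr >-> borel_plane R}) : uniform_on C X ->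
  exists2 A : R, 0 < A & area C = A%:E.
Proof.
move=> /(_ setT measurableT); rewrite setTI /distribution /pushforward.
rewrite preimage_setT probability_setT.
have : (0 <= area C)%E.
  by apply: integral_ge0 => x _; exact: measure_ge0.
case: (area C) => [A|_|//].
  rewrite lee_fin => A0 H; exists A => //; rewrite lt_neqAle A0 andbT; apply/negP => /eqP A_eq.
  by move: H; rewrite -A_eq mul0e => /eqP; rewrite eqe oner_eq0.
by rewrite invey mule0 => /eqP; rewrite eqe oner_eq0.
Qed.

Lemma law_box (C : set (R * R)) (A : R) (d : measure_display)
    (T : measurableType d) (Pr : probability T R)
    (X : {RV Pr >-> borel_plane R}) (z : R * R) (e : R) :
  uniform_on C X -> 0 < A -> area C = A%:E -> 0 < e -> box z e `<=` C ->
  fine (distribution Pr X (box z e)) = (2 * e) ^+ 2 / A.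
Proof.
move=> X_unif A0 CA e0 zC; rewrite X_unif; last exact: measurable_box.
by rewrite (setIidl zC) CA area_box// inver gt_eqF.
Qed.
End Uniform.

(** * Existence of a square of the given type *)

Lemma hit_same_type (R : realType) (n k : nat) (T : Type) (A Q : set (R * R))
    (a : 'I_k -> R * R) (B : 'I_k -> set (R * R)) (X : 'I_n -> T -> R * R)
    (f : 'I_k -> 'I_n) (w : T) :
  general_position A -> injective a -> range a = A -> injective f ->
  (forall i, B i `<=` Q) ->
  (forall i i', i != i' -> B i `&` B i' = set0) ->
  (forall b : 'I_k -> R * R, (forall i, B i (b i)) ->
    forall h i j : 'I_k, (h < i)%N -> (i < j)%N ->
    orientation (a h) (a i) (a j) = orientation (b h) (b i) (b j)) ->
  hit X Q B f w -> same_type A (range (fun i => X i w) `&` Q).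
Proof.
move=> gpA a_inj aA f_inj BQ Bdisj Bor Hw; apply/same_typeP; split => //.
have XB i : B i (X (f i) w) by have := Hw (f i) I; rewrite /= slot_in.
exists k, a, (fun i => X (f i) w); split => //.
- move=> i i' e; apply/eqP; apply: contraT => ii'.
  have : (B i `&` B i') (X (f i) w) by split => //; rewrite e.
  by rewrite Bdisj.
- apply/seteqP; split => [_ [i _ <-]|_ [[j _ <-] Qj]].
    by split; [exists (f i)|exact: BQ (XB i)].
  have [/codomP[i ji]|jf] := boolP (j \in codom f); first by exists i; rewrite ?ji.
  by have := Hw j I; rewrite /= slot_out.
- exact: Bor.
Qed.

Lemma measurable_event (R : realType) (n : nat) (d : measure_display)
    (T : measurableType d) (h : R) (G : set (set (R * R))) (A : set (R * R))
    (X : 'I_n -> T -> borel_plane R) :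
  square_grid h G -> (forall j, measurable_fun setT (X j)) ->
  measurable [set w | exists2 Q, G Q &
    same_type A (range (fun i => X i w : R * R) `&` Q)].
Proof.
move=> [] o [u [_ ->]] mX.
rewrite (_ : [set w | _] = [set w | exists i j : int,
    same_type A (range (fun l => X l w : R * R) `&` grid_square h o u i j)]).
  do 2 apply: measurable_exists => ?; apply: measurable_same_type => //.
  exact: measurable_grid_square.
apply/seteqP; split => w /=; first by move=> [_ [i [j ->]] H]; exists i, j.
by move=> [i [j H]]; exists (grid_square h o u i j) => //; exists i, j.
Qed.

Theorem theorem3 (R : realType) (C : set (R * R))
  (C_compact : compact C) (C_convex : convex_set C) (C_int : C° !=set0)
  (d : nat -> measure_display) (Omega : forall n : nat, measurableType (d n))
  (Pr : forall n : nat, probability (Omega n) R)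
  (X : forall n : nat, 'I_n -> {RV (Pr n) >-> borel_plane R})
  (X_unif : forall n : nat, (1 <= n)%N -> forall i : 'I_n, uniform_on C (X n i))
  (X_indep : forall n : nat, (1 <= n)%N -> independent_RVs (X n))
  (G : nat -> set (set (R * R)))
  (G_grid : forall n : nat, (1 <= n)%N -> square_grid (Num.sqrt n%:R)^-1 (G n))
  (P : set (set (R * R))) (P_type : order_type P) :
  (fun n : nat => Pr n [set w : Omega n |
     exists2 Q : set (R * R), G n Q & P (range (fun i : 'I_n => X n i w) `&` Q)])
    @ \oo --> (1%E : \bar R).
Proof.
have [A0 [finA gpA P_eq]] := P_type.
have [k [a [a_inj aA]]] := finite_set_enum finA.
have gpa : general_position (range a) by rewrite aA.
have [rho rho0 patterns] := square_grid_patterns a_inj gpa.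
have [c /nbhs_ballP[r /= r0 rC]] := C_int.
have [A A_gt0 CA] := area_support (X_unif 1%N isT ord0).
pose E n : set (Omega n) := [set w | exists2 Q : set (R * R), G n Q &
  P (range (fun i : 'I_n => X n i w) `&` Q)].
rewrite -[X in X @ \oo]/(fun n => Pr n (E n)).
have mE n : (0 < n)%N -> measurable (E n).
  by move=> n0; rewrite /E P_eq; exact: measurable_event (G_grid n n0) _.
(* g / n is the probability of one box, q / n bounds that of one square *)
pose g := (2 * rho) ^+ 2 / A; pose q := 4 / A.
have g0 : 0 < g by rewrite divr_gt0// exprn_gt0// mulr_gt0.
have q0 : 0 < q by rewrite divr_gt0.
pose kappa := (g / 2) ^+ k * expR (- (2 * q)).
have kappa0 : 0 < kappa by rewrite mulr_gt0 ?expR_gt0// exprn_gt0// divr_gt0.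
suff main (e : R) : 0 < e -> \forall n \near \oo, 1 - e <= fine (Pr n (E n)).
  apply/fine_cvgP; split.
    near=> n; rewrite fin_num_measure//; apply: mE.
    by near: n; exact: nbhs_infty_gt.
  apply/cvgrPdist_le => e e0; near=> n => /=.
  have n0 : (0 < n)%N by near: n; exact: nbhs_infty_gt.
  have : fine (Pr n (E n)) <= 1.
    by rewrite -[leRHS]/(fine 1%E) fine_le ?fin_num_measure// ?probability_le1//; exact: mE.
  have : 1 - e <= fine (Pr n (E n)) by near: n; exact: main.
  by rewrite ler_norml => ? ?; apply/andP; split; lra.
move=> e0; pose M := (Num.truncn (2 / (e * kappa))).+1.
have MK0 : 0 < M%:R * kappa by apply: mulr_gt0; rewrite ?ltr0n.
have MK : (M%:R * kappa)^-1 <= e / 2.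
  rewrite -[leRHS]invrK lef_pV2 ?posrE ?invr_gt0 ?divr_gt0//.
  rewrite -ler_pdivrMr// ltW//; apply: le_lt_trans (truncnS_gt _).
  by rewrite le_eqVlt; apply/orP; left; apply/eqP; field; rewrite !gt_eqF.
near=> n.
have n0 : (0 < n)%N by near: n; exact: nbhs_infty_gt.
have n0' : 0 < n%:R :> R by rewrite ltr0n.
have kn : (2 * k <= n)%N by near: n; exact: nbhs_infty_ge.
have qn : 2 * q <= n%:R by near: n; exact: nbhs_infty_ger.
(* this is the hypothesis of [invXn_le] for the exponent 2 k and e / 2 *)
have qn' : (2 * k)%:R * q * (1 + e / 2) / (e / 2) <= n%:R.
  by near: n; exact: nbhs_infty_ger.
(* this makes the mesh small enough for the M squares to stay inside C *)
have rn : ((M%:R * 2 + 2) * (2 / r)) ^+ 2 <= n%:R by near: n; exact: nbhs_infty_ger.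
pose h : R := (Num.sqrt n%:R)^-1.
have h0 : 0 < h by rewrite invr_gt0 sqrtr_gt0.
have h2 : h ^+ 2 = n%:R^-1 by rewrite exprVn sqr_sqrtr// ltW.
have M2 : 0 < M%:R * 2 + 2 :> R by rewrite ltr_wpDl// mulr_ge0.
have hr : (M%:R * 2 + 2) * h < r.
  have : (M%:R * 2 + 2) * (2 / r) <= Num.sqrt n%:R.
    rewrite -(ler_pXn2r (n := 2)) ?nnegrE ?sqrtr_ge0//; last first.
      by rewrite mulr_ge0 ?divr_ge0// ltW.
    by rewrite sqr_sqrtr// ltW.
  rewrite mulrA ler_pdivrMr// => H; rewrite ltr_pdivrMr ?sqrtr_gt0//.
  by apply: lt_le_trans (_ : _ < (M%:R * 2 + 2) * 2) _; [lra|rewrite [leRHS]mulrC].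
have cC : box c ((M%:R * 2 + 2) * h) `<=` C.
  move=> x [x1 x2]; apply: rC; split; rewrite /ball/= distrC.
    exact: le_lt_trans x1 hr.
  exact: le_lt_trans x2 hr.
have [Q [z [y [QG Qz Qdisj yQ yor]]]] := patterns M c h (G n) h0 (G_grid n n0).
pose j0 : 'I_n := Ordinal n0.
pose nu : probability (borel_plane R) R := distribution (Pr n) (X n j0).
have X_law j S : measurable S -> Pr n (X n j @^-1` S) = nu S.
  move=> mS; have := X_unif n n0 j S mS.
  by rewrite -(X_unif n n0 j0 S mS).
pose B m i := box (y m i) (rho * h).
have mQ m : measurable (Q m : set (borel_plane R)).
  have [] := G_grid n n0 => o [u [_ Geq]].
  by have := QG m; rewrite Geq => -[i [j ->]]; exact: measurable_grid_square.
have lawQ m : fine (nu (Q m)) <= q / n%:R.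
  have [Qb bc] := Qz m.
  have := law_box (X_unif n n0 j0) A_gt0 CA h0 (subset_trans bc cC).
  rewrite exprMn h2 -/nu => box_eq.
  apply: le_trans (_ : fine (nu (box (z m) h)) <= _).
    rewrite fine_le ?fin_num_measure//; try exact: measurable_box.
    by rewrite le_measure// inE//; exact: measurable_box.
  rewrite box_eq le_eqVlt; apply/orP; left; apply/eqP.
  by rewrite /q; field; rewrite !gt_eqF.
have lawB m i : g / n%:R <= fine (nu (B m i)).
  have BC : B m i `<=` C.
    apply: subset_trans (yQ m i) _; apply: subset_trans (Qz m).1 _.
    exact: subset_trans (Qz m).2 cC.
  rewrite (law_box (X_unif n n0 j0) A_gt0 CA _ BC) ?mulr_gt0//.
  rewrite mulrA exprMn h2 le_eqVlt; apply/orP; left; apply/eqP.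
  by rewrite /g; field; rewrite !gt_eqF.
have p_bounds : 0 <= q / n%:R < 1.
  by rewrite divr_ge0 ?ltW//= ltr_pdivrMr//; lra.
have no_hit := prob_no_hit (X_indep n n0) X_law mQ
  (fun m i => measurable_box _ _) yQ (fun m => (yor m).1) Qdisj p_bounds
  (divr_gt0 g0 n0') lawQ lawB (ltn0Sn _) (leq_trans (leq_pmull k (ltn0Sn 1)) kn).
set U := \bigcup_mf _ in no_hit.
have UE : U `<=` E n.
  move=> w [[m f] _ /= Hw]; exists (Q m) => //; rewrite P_eq /=.
  apply: (hit_same_type gpA a_inj aA _ (yQ m) (yor m).1 (yor m).2 Hw).
  by apply/injectiveP; exact: (valP f).
have mU : measurable U.
  apply: fin_bigcup_measurable => [|mf _]; first exact: finite_finset.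
  by apply: measurable_hit => // i; exact: measurable_box.
have UEn : fine (Pr n U) <= fine (Pr n (E n)).
  by rewrite fine_le ?fin_num_measure ?le_measure ?inE//; exact: mE.
apply: le_trans UEn.
rewrite probability_setC// fineB ?fin_num_measure//= in no_hit.
have W : (1 - q / n%:R)^-1 ^+ (2 * k) <= 1 + e / 2.
  apply: invXn_le => //; first by rewrite divr_gt0.
  move: qn'; rewrite ler_pdivrMr ?divr_gt0// => qn'.
  rewrite mulrA -mulrAC ler_pdivrMr//.
  by rewrite [e / 2 * _]mulrC.
have K := occupancy_ge g0 q0 n0 kn qn; rewrite -/kappa in K.
have : (M%:R * ((n ^_ k)%:R * ((g / n%:R) ^+ k * (1 - q / n%:R) ^+ n)))^-1 <= e / 2.
  have M0 : 0 < M%:R :> R by rewrite ltr0n.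
  have K0 := lt_le_trans kappa0 K.
  by apply: le_trans MK; rewrite lef_pV2 ?posrE ?ler_pM2l// mulr_gt0.
by move: no_hit W; lra.
Unshelve. all: by end_near. Qed.
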